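(* Consider $\mathbb{R}^n$ endowed with the metric $d(x,y)=\|x-y\|$, where $\|\cdot\|$ is any norm on $\mathbb{R}^n$. Let $\mathcal{D}\subset(\mathbb{R}^n)^{\mathbb{Z}}$ be a set of sequences $P$ with $\delta(P)<\infty$, and let $S_2$ be a subdivision scheme defined on $\mathbb{R}^n$ that has a first-order contractivity factor $\mu_1\in(0,1)$ and first-order contractivity level $L_1\in\mathbb{N}$ in $\mathcal{D}$, i.e. for every $k\in\{0,1,2,\ldots\}$ and every level-$k$ sequence $P^k\in\mathcal{D}$, $$\delta\!\left(\frac{\Delta(S_2^{L_1}(P^k))}{2^{-(k+L_1)}}\right)\le\mu_1\,\delta\!\left(\frac{\Delta P^k}{2^{-k}}\right).$$ Let $S_1$ be a subdivision scheme defined on $\mathbb{R}^n$ satisfying: 1. $S_1$ is defined relative to the same parameter sequences as $S_2$. 2. For all $P\in\mathcal{D}$, $S_1(P)\in\mathcal{D}$. 3. $S_1^{L_1}$ is in proximity of the second type of order $1$ with $S_2^{L_1}$ in $\mathcal{D}$, with proximity factor $0<\eta<2^{-L_1}$. 4. $S_1$ is displacement-safe in $\mathcal{D}$. Then $S_1$ converges to a $C^1$ limit from any $P\in\mathcal{D}$.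
   Context: **Notation.** For $P=\{p_j\}_{j\in\mathbb{Z}}\in(\mathbb{R}^n)^{\mathbb{Z}}$: $(\Delta P)_j=p_{j+1}-p_j$ and $\delta(P)=\sup_{j\in\mathbb{Z}}\|p_{j+1}-p_j\|$. A level-$k$ sequence is a sequence associated with the parameters $T^k$ of refinement level $k$. **Subdivision scheme.** A binary refinement operator is a map $S:(\mathbb{R}^n)^{\mathbb{Z}}\to(\mathbb{R}^n)^{\mathbb{Z}}$ that is local: there is $M_S\in\mathbb{N}$ such that for all $j\in\mathbb{Z}$, $S(P)_{2j}$ and $S(P)_{2j+1}$ do not depend on $P_\ell$ for $\ell<j-M_S$ or $\ell>j+M_S$. A subdivision scheme is the repeated application $P^k=S(P^{k-1})$, $k\in\mathbb{N}$, where $P^k$ is associated with a parameter sequence $T^k=\{t_j^k\}_{j\in\mathbb{Z}}$, which is either the primal one, $t_j^k=j2^{-k}$, or the dual one, $t_j^k=j2^{-k}+\sum_{\ell=2}^{k+1}2^{-\ell}$ (empty sum for $k=0$). **Convergence.** $S_1$ converges from $P$ to $Q^\infty:\mathbb{R}\to\mathbb{R}^n$ if the piecewise linear interpolants $f^k$ of the points $\{(t_j^k,S_1^k(P)_j)\}_{j\in\mathbb{Z}}$ converge to $Q^\infty$ uniformly on $\mathbb{R}$ (the average used on $\mathbb{R}^n$ is the arithmetic average $A_\omega(x,y)=(1-\omega)x+\omega y$). **Displacement-safe.** $S_1$ is displacement-safe in $\mathcal{D}$ if there is a constant $C_{S_1}\ge0$, independent of $P$, such that $\|S_1(P)_{2j}-p_j\|\le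 C_{S_1}\delta(P)$ for all $j\in\mathbb{Z}$, $P\in\mathcal{D}$. **Second-type proximity.** $S_1^{L_1}$ is in proximity of the second type of order $m$ with $S_2^{L_1}$ in $\mathcal{D}$, with proximity factor $\eta$, if $0<\eta<(1/2)^m$, $\eta$ is independent of $P$ and $j$, and for every $P\in\mathcal{D}$ there is a constant $E>0$ (which may depend on $P$ but not on $j$) with $$\sup_{i\in\mathbb{Z}}\bigl\|S_1^{L_1}(S_1^{jL_1}(P))_i-S_2^{L_1}(S_1^{jL_1}(P))_i\bigr\|\le E\,\eta^{j+1},\qquad j=0,1,2,\ldots$$ *)

(* Defs.v *)
From HB Require Import structures.
From mathcomp Require Import all_boot all_order all_algebra.
From mathcomp Require Import all_classical all_reals all_analysis.
Import Order.TTheory GRing.Theory Num.Theory.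
Import numFieldNormedType.Exports.

Set Implicit Arguments.
Unset Strict Implicit.
Unset Printing Implicit Defensive.

Local Open Scope classical_set_scope.
Local Open Scope ring_scope.

(** [R^n] is ['rV[R]_n], and a norm on it is a function [N] satisfying
    [is_norm N], independent of the library's instance [`|_|] (the max norm).
    Suprema are taken in [\bar R], so that they may be infinite. *)

Record is_norm (R : realType) (n : nat) (N : 'rV[R]_n -> R) : Prop := IsNorm {
  norm_definite : forall x, N x = 0 -> x = 0 ;
  norm_homogeneous : forall (a : R) x, N (a *: x) = `|a| * N x ;
  norm_triangle : forall x y, N (x + y) <= N x + N y }.

Definition Delta (R : realType) (n : nat) (P : int -> 'rV[R]_n) :
  int -> 'rV[R]_n := fun j => P (j + 1) - P j.

Definition delta (R : realType) (n : nat) (N : 'rV[R]_n -> R)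
    (P : int -> 'rV[R]_n) : \bar R :=
  ereal_sup (range (fun j => (N (P (j + 1) - P j))%:E)).

Definition local_operator (R : realType) (n : nat)
    (S : (int -> 'rV[R]_n) -> (int -> 'rV[R]_n)) : Prop :=
  exists M : nat, forall (j : int) (P P' : int -> 'rV[R]_n),
    (forall l : int, j - M%:Z <= l <= j + M%:Z -> P l = P' l) ->
    S P (2 * j) = S P' (2 * j) /\ S P (2 * j + 1) = S P' (2 * j + 1).

Variant parametrization := Primal | Dual.

Definition knot (R : realType) (T : parametrization) (k : nat) (j : int) : R :=
  match T with
  | Primal => j%:~R * 2 ^- k
  | Dual => j%:~R * 2 ^- k + \sum_(2 <= l < k.+2) 2 ^- l
  end.

(** The level-[k] points generated from [P] by a scheme [S] are [iter k S P]. *)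
Record scheme (R : realType) (n : nat) := Scheme {
  refine :> (int -> 'rV[R]_n) -> (int -> 'rV[R]_n) ;
  refine_local : local_operator refine ;
  params : parametrization }.

Definition average (R : realType) (n : nat) (w : R) (x y : 'rV[R]_n) :
  'rV[R]_n := (1 - w) *: x + w *: y.

Definition pl_interpolant (R : realType) (n : nat) (t : int -> R)
    (P : int -> 'rV[R]_n) (f : R -> 'rV[R]_n) : Prop :=
  forall (j : int) (x : R), t j <= x <= t (j + 1) ->
    f x = average ((x - t j) / (t (j + 1) - t j)) (P j) (P (j + 1)).

Definition converges_to (R : realType) (n : nat) (N : 'rV[R]_n -> R)
    (S : scheme R n) (P : int -> 'rV[R]_n) (Q : R -> 'rV[R]_n) : Prop :=
  exists f : nat -> R -> 'rV[R]_n,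
    (forall k, pl_interpolant (knot R (params S) k) (iter k S P) (f k)) /\
    (forall e : R, 0 < e ->
       \forall k \near \oo, forall x : R, N (f k x - Q x) < e).

(** Differentiation is with respect to the library's norm on ['rV[R]_n]; all
    norms on [R^n] being equivalent, this is the [C^1] property for each. *)
Definition C1 (R : realType) (n : nat) (Q : R -> 'rV[R]_n) : Prop :=
  (forall x : R, derivable Q x 1) /\ continuous (derive1 Q).

Definition displacement_safe (R : realType) (n : nat) (N : 'rV[R]_n -> R)
    (D : set (int -> 'rV[R]_n)) (S : scheme R n) : Prop :=
  exists2 C : R, 0 <= C &
    forall (P : int -> 'rV[R]_n) (j : int), D P ->
      ((N (S P (2 * j) - P j))%:E <= C%:E * delta N P)%E.

(** [first_divided_diff k P] is [Delta P / 2^{-k}]. *)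
Definition first_divided_diff (R : realType) (n : nat) (k : nat)
    (P : int -> 'rV[R]_n) : int -> 'rV[R]_n :=
  fun j => (2 ^- k)^-1 *: Delta P j.

(** A level-[k] sequence is any sequence, seen as attached to the parameters of
    level [k]; hence [k] and [P] are quantified independently. *)
Definition first_order_contractive (R : realType) (n : nat)
    (N : 'rV[R]_n -> R) (D : set (int -> 'rV[R]_n)) (S : scheme R n)
    (mu : R) (L : nat) : Prop :=
  forall (k : nat) (P : int -> 'rV[R]_n), D P ->
    (delta N (first_divided_diff (k + L) (iter L S P)) <=
       mu%:E * delta N (first_divided_diff k P))%E.

(** [S1^L] is in proximity of the second type of order [m] with [S2^L]. *)
Definition second_type_proximity (R : realType) (n : nat)
    (N : 'rV[R]_n -> R) (D : set (int -> 'rV[R]_n)) (S1 S2 : scheme R n)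
    (L m : nat) (eta : R) : Prop :=
  0 < eta < (1 / 2) ^+ m /\
  forall P : int -> 'rV[R]_n, D P ->
    exists2 E : R, 0 < E &
      forall j : nat,
        (ereal_sup (range (fun i : int =>
           (N (iter L S1 (iter (j * L) S1 P) i
               - iter L S2 (iter (j * L) S1 P) i))%:E))
         <= (E * eta ^+ j.+1)%:E)%E.

(* Main.v *)
From HB Require Import structures.
Require Import Defs.
From mathcomp Require Import all_boot all_order all_algebra.
From mathcomp Require Import all_classical all_reals all_analysis.
From mathcomp Require Import zify ring lra.
Import Order.TTheory GRing.Theory Num.Theory.
Import numFieldNormedType.Exports.
Set Implicit Arguments.
Unset Strict Implicit.
Unset Printing Implicit Defensive.
Local Open Scope classical_set_scope.
Local Open Scope ring_scope.

(** Write [P^k = S1^k P].  Contractivity of [S2] together with the proximity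
    estimate makes the second differences of [P^k] smaller than [2^-k] by a
    geometric factor: they are [O((sigma^2/2)^k)] for some [sigma < 1].
    Proximity only controls the levels divisible by [L1], with a constant that
    depends on the initial data; applying it to each of [P, S1 P, ...,
    S1^(L1-1) P], all of which lie in [D], covers every level
    ([second_edge_decay]).

    The point of the proof is to pass from second differences to slopes
    [v^k_i = 2^k (P^k_(i+1) - P^k_i)].  Displacement-safety only says that
    [P^(k+1)_(2i) - P^k_i] is at most a constant times the longest edge, which is
    of the same size as the edges to be compared; so a single edge of level [k]
    says nothing about the edges that refine it.  A chord over [m] consecutive
    edges does better.  Its mean slope changes by [O(1/m)] from one level to the
    next, and it differs from the slope of its first edge by [m] times the second
    differences.  With [m] of the order of [sigma^-k] the slopes change by
    at most a multiple of [sigma^k] times one plus the largest slope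
    ([edge_refine_le], [slope_refine]).  The powers of [sigma] are summable, so
    the slopes stay bounded ([slope_bounded]), and then they change by
    [O(sigma^k)] from level [k] to level [k+1].

    Hence the piecewise linear interpolants converge uniformly to some [Q], and
    the piecewise constant slopes converge uniformly to some [S].  Adjacent slopes
    of level [k] differ by [O(sigma^k)], which makes [S] uniformly continuous
    in spite of the jumps; the mean value inequality for piecewise linear
    functions survives in the limit and gives [Q' = S]
    ([limit_mean_value], [flattening_levels_C1]).

    All of this takes place in a complete normed module.  The arbitrary norm [N]
    enters through its equivalence with the norm that carries the topology of
    [R^n], which follows from compactness of the unit sphere ([is_norm_ge]). *)

(** * Chords and second differences *)

(** [Delta] in an arbitrary abelian group: it is applied below to points and
    slopes in a normed module as well as to points of [R^n]. *)
Definition edge (V : zmodType) (p : int -> V) : int -> V :=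
  fun i => p (i + 1) - p i.

Lemma norm_shift_le (R : realType) (V : normedModType R) (f : int -> V) (s : R) :
  (forall i, `|edge f i| <= s) ->
  forall (m : nat) i, `|f (i + m%:Z) - f i| <= m%:R * s.
Proof.
move=> fs; elim=> [|m IHm] i; first by rewrite addr0 subrr normr0 mul0r.
have -> : i + m.+1%:Z = i + m%:Z + 1 by lia.
have -> : f (i + m%:Z + 1) - f i = edge f (i + m%:Z) + (f (i + m%:Z) - f i).
  by rewrite /edge subrKA.
rewrite (le_trans (ler_normD _ _))// -natr1 mulrDl mul1r addrC.
exact: lerD.
Qed.

Lemma norm_dist_le (R : realType) (V : normedModType R) (f : int -> V) (s : R) :
  (forall i, `|edge f i| <= s) ->
  forall i j, `|f i - f j| <= `|i - j|%:~R * s.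
Proof.
move=> fs i j; wlog le_ji : i j / j <= i.
  move=> H; have [/H//|/ltW/H] := leP j i.
  by rewrite distrC [`|j - i|]distrC.
have := norm_shift_le fs `|i - j|%N j.
have -> : j + `|i - j|%N%:Z = i by lia.
by rewrite -[X in _ -> _ <= X * _]natr_absz pmulrn.
Qed.

(** A chord over [m] edges departs from [m] copies of its first edge by the
    accumulated bending, which is quadratic in [m]. *)
Lemma chord_le (R : realType) (V : normedModType R) (p : int -> V) (s : R) :
  (forall i, `|edge (edge p) i| <= s) ->
  forall (m : nat) i,
    `|p (i + m%:Z) - p i - m%:R *: edge p i| <= m%:R ^+ 2 * s.
Proof.
move=> ps; have s0 : 0 <= s by rewrite (le_trans _ (ps 0)).
elim=> [|m IHm] i.
  by rewrite addr0 subrr scale0r subrr normr0 expr0n mul0r.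
have -> : p (i + m.+1%:Z) - p i - m.+1%:R *: edge p i =
    (edge p (i + m%:Z) - edge p i) +
    (p (i + m%:Z) - p i - m%:R *: edge p i).
  have -> : i + m.+1%:Z = i + m%:Z + 1 by lia.
  by rewrite addrACA subrKA -opprD -natr1 scalerDl scale1r [edge p i + _]addrC.
rewrite (le_trans (ler_normD _ _))//.
have := IHm i; have := norm_shift_le ps m i.
rewrite -natr1; set x := `|_|; set y := `|_| => xm ym.
have m0 : 0 <= m%:R * s :> R by rewrite mulr_ge0.
nra.
Qed.

(** The window estimate.  Both edges are compared with chords that start at the
    same place and span the same part of the curve, [m] edges of [p] and [2 m]
    edges of [q].  The ends of the two chords are displaced by [c] at most, and
    this error is divided by [m]; the bending costs a factor [m].  The
    freedom to choose [m] is what makes the bound useful when [c] is not small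
    compared with the edges. *)
Lemma edge_refine_le (R : realType) (V : normedModType R) (p q : int -> V)
    (c s s' : R) (m : nat) (i : int) :
  (0 < m)%N ->
  (forall j, `|q (2 * j) - p j| <= c) ->
  (forall j, `|edge (edge p) j| <= s) ->
  (forall j, `|edge (edge q) j| <= s') ->
  `|2 *: edge q (2 * i) - edge p i| <= m%:R * (4 * s' + s) + 2 * c / m%:R.
Proof.
move=> m0 qp ps qs.
have mR : 0 < m%:R :> R by rewrite ltr0n.
rewrite -(ler_pM2l mR) -[X in X * `|_|]gtr0_norm// -normrZ.
have -> : m%:R *: (2 *: edge q (2 * i) - edge p i) =
   (p (i + m%:Z) - p i - m%:R *: edge p i)
   - (q (2 * i + (2 * m)%:Z) - q (2 * i) - (2 * m)%:R *: edge q (2 * i))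
   + ((q (2 * (i + m%:Z)) - p (i + m%:Z)) - (q (2 * i) - p i)).
  rewrite scalerBr scalerA natrM [m%:R * 2]mulrC.
  have -> : 2 * i + (2 * m)%:Z = 2 * (i + m%:Z) by lia.
  set X := _ *: edge q _; set Y := _ *: _.
  set a := q _; set b := p _; set u := q _; set v := p _.
  have -> : a - b - (u - v) = (a - u) - (b - v).
    by rewrite !opprB addrACA [- b - u]addrC addrACA.
  by rewrite opprB [b - v - Y + _]addrC addrAC !subrKA.
have := chord_le ps m i; have := chord_le qs (2 * m) (2 * i).
have -> : m%:R * (m%:R * (4 * s' + s) + 2 * c / m%:R) =
    m%:R ^+ 2 * (4 * s' + s) + 2 * c by field; rewrite gt_eqF.
have := qp i; have := qp (i + m%:Z).
move=> h1 h2 h3 h4.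
apply: (le_trans (ler_normD _ _)).
apply: (le_trans (lerD (ler_normB _ _) (ler_normB _ _))).
move: h3; rewrite natrM => h3.
nra.
Qed.

(** Window lengths are integers; rounding the ideal length [x] up at most
    doubles it. *)
Lemma exists_window (R : realType) (x : R) : 1 <= x ->
  exists2 m : nat, (0 < m)%N & x <= m%:R <= 2 * x.
Proof.
move=> x1; exists (Num.truncn x).+1 => //.
have h1 : (Num.truncn x)%:R <= x by rewrite truncn_le (le_trans ler01).
have h2 := truncnS_gt x.
by rewrite ltW//=; rewrite -natr1; lra.
Qed.

(** * Slopes from level to level *)
Definition slope (R : realType) (V : normedModType R) (p : nat -> int -> V)
  (k : nat) (i : int) : V := 2 ^+ k *: edge (p k) i.

(** The properties of the refined points that force a [C^1] limit, freed from
    subdivision operators and norms on [R^n].  The factor of the second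
    differences is written [sigma ^+ 2 / 2] because the windows of length
    [sigma ^- k] use up one of the two factors [sigma]. *)
Record flattening_levels (R : realType) (V : normedModType R)
    (p : nat -> int -> V) (C A sigma : R) : Prop := FlatteningLevels {
  flat_C_ge0 : 0 <= C ;
  flat_A_ge0 : 0 <= A ;
  flat_sigma : 0 < sigma < 1 ;
  flat_initial : exists d : R, forall i, `|edge (p 0) i| <= d ;
  flat_displacement : forall (k : nat) (d : R),
    (forall i, `|edge (p k) i| <= d) ->
    forall i, `|p k.+1 (2 * i) - p k i| <= C * d ;
  flat_second : forall k i,
    `|edge (edge (p k)) i| <= A * (sigma ^+ 2 / 2) ^+ k }.

Lemma slope_adjacent (R : realType) (V : normedModType R)
    (p : nat -> int -> V) (C A sigma : R) :
  flattening_levels p C A sigma ->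
  forall k i, `|edge (slope p k) i| <= A * sigma ^+ k.
Proof.
move=> [_ A0 /andP[/ltW s0 /ltW s1] _ _ psec] k i.
have -> : edge (slope p k) i = 2 ^+ k *: edge (edge (p k)) i.
  by rewrite [in RHS]/edge scalerBr.
rewrite normrZ ger0_norm ?exprn_ge0//.
apply: (le_trans (ler_wpM2l _ (psec k i))); first by rewrite exprn_ge0.
rewrite mulrCA -exprMn mulrCA divff// mulr1 -exprM mulnC exprM.
by rewrite ler_wpM2l// expr2 ler_piMl ?exprn_ge0 ?exprn_ile1.
Qed.

(** [edge_refine_le] with [m] between [sigma ^- k] and twice that: the bending
    [m * sigma ^+ (2 * k)] and the displacement [1 / m], both measured after
    multiplication by [2 ^+ k], are then of order [sigma ^+ k]. *)
Lemma slope_refine (R : realType) (V : normedModType R)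
    (p : nat -> int -> V) (C A sigma d : R) (k : nat) :
  flattening_levels p C A sigma ->
  (forall i, `|slope p k i| <= d) ->
  forall i, `|slope p k.+1 (2 * i) - slope p k i|
    <= (6 * A + 2 * C * d) * sigma ^+ k.
Proof.
move=> [C0 A0 /andP[s0 s1] _ pdis psec] pd i.
have t0 : 0 < 2 ^+ k :> R by rewrite exprn_gt0.
have d0 : 0 <= d by rewrite (le_trans _ (pd 0)).
have sk0 : 0 < sigma ^+ k by rewrite exprn_gt0.
have ed j : `|edge (p k) j| <= d / 2 ^+ k.
  have := pd j; rewrite /slope normrZ gtr0_norm// => h.
  by rewrite ler_pdivlMr// mulrC.
have [|m m0 /andP[m1 m2]] := @exists_window R (sigma ^- k).
  by rewrite invf_ge1// exprn_ile1 ?(ltW s0) ?(ltW s1).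
have mR : 0 < m%:R :> R by rewrite ltr0n.
have := edge_refine_le i m0 (pdis _ _ ed) (psec k) (psec k.+1).
have -> : slope p k.+1 (2 * i) - slope p k i =
    2 ^+ k *: (2 *: edge (p k.+1) (2 * i) - edge (p k) i).
  by rewrite /slope [in RHS]scalerBr [in RHS]scalerA -exprSr.
rewrite normrZ gtr0_norm// => h.
apply: (le_trans (ler_wpM2l (ltW t0) h)).
rewrite exprS; set y := (_ / 2) ^+ k.
have yE : 2 ^+ k * y = sigma ^+ k ^+ 2.
  by rewrite -exprMn mulrCA divff// mulr1 -exprM mulnC exprM.
set q := sigma ^+ k in yE m1 m2 sk0 *.
have -> : 2 ^+ k * (m%:R * (4 * (A * (sigma ^+ 2 / 2 * y)) + A * y)
    + 2 * (C * (d / 2 ^+ k)) / m%:R) =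
    m%:R * A * (2 * sigma ^+ 2 + 1) * (2 ^+ k * y) + 2 * C * d * m%:R^-1.
  by field; rewrite !gt_eqF.
(* The first term is the bending and the second one the displacement. *)
rewrite yE [leRHS]mulrDl lerD//.
- have mq : m%:R * q <= 2 by rewrite -ler_pdivlMr.
  have s2 : sigma ^+ 2 <= 1 by rewrite exprn_ile1 ?(ltW s0) ?(ltW s1).
  have -> : m%:R * A * (2 * sigma ^+ 2 + 1) * q ^+ 2 =
    (m%:R * q) * (A * q) * (2 * sigma ^+ 2 + 1) by ring.
  have -> : 6 * A * q = 2 * (A * q) * 3 by ring.
  have Aq : 0 <= A * q by rewrite mulr_ge0// ltW.
  apply: ler_pM => //; first by rewrite !mulr_ge0// ltW.
  + by rewrite addr_ge0// mulr_ge0// exprn_ge0// ltW.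
  + by rewrite ler_wpM2r.
  + by lra.
- rewrite ler_wpM2l ?mulr_ge0//.
  by rewrite -[leRHS]invrK lef_pV2 ?posrE ?invr_gt0.
Qed.

Lemma int_even_or_odd (i : int) : exists j : int, i = 2 * j \/ i = 2 * j + 1.
Proof. by exists (i %/ 2)%Z; lia. Qed.

(** If [d] bounds the slopes of level [k], then
    [d + (7 * A + 2 * C * d) * sigma ^+ k] bounds those of level [k + 1]: those of
    even index by [slope_refine], the others because they are adjacent to one of
    even index.  So [d + 1] is multiplied by [1 + c * sigma ^+ k] at most, and the
    product of these factors converges. *)
Lemma slope_bounded (R : realType) (V : normedModType R)
    (p : nat -> int -> V) (C A sigma : R) :
  flattening_levels p C A sigma ->
  exists d : R, forall k i, `|slope p k i| <= d.
Proof.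
move=> flat; have [C0 A0 /andP[s0 s1] [d pd] _ _] := flat.
have d0 : 0 <= d by rewrite (le_trans _ (pd 0)).
pose c : R := 7 * A + 2 * C.
have c0 : 0 <= c by rewrite addr_ge0 ?mulr_ge0.
have os : 0 < 1 - sigma by rewrite subr_gt0.
(* The exponent is [c] times the sum of [sigma ^+ l] over [l < k]. *)
pose B k : R := (d + 1) * expR (c * (1 - sigma ^+ k) / (1 - sigma)) - 1.
have pB : forall k i, `|slope p k i| <= B k.
  elim=> [|k IHk] i.
    rewrite /B expr0 subrr mulr0 mul0r expR0 mulr1 addrK.
    by rewrite /slope expr0 scale1r.
  have B0 : 0 <= B k by rewrite (le_trans _ (IHk 0)).
  have sk0 : 0 <= sigma ^+ k by rewrite exprn_ge0// ltW.
  have BS : (B k + 1) * (1 + c * sigma ^+ k) - 1 <= B k.+1.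
    have -> : B k.+1 = (B k + 1) * expR (c * sigma ^+ k) - 1.
      rewrite /B subrK -[in RHS]mulrA -[in RHS]expRD; congr (_ * expR _ - _).
      by rewrite exprS; field; rewrite gt_eqF.
    by rewrite lerB// ler_wpM2l ?expR_ge1Dx// ltW// ltr_wpDl.
  apply: le_trans BS.
  have even j : `|slope p k.+1 (2 * j)| <=
      B k + (6 * A + 2 * C * B k) * sigma ^+ k.
    rewrite -[slope _ _ _](subrK (slope p k j)) addrC.
    rewrite (le_trans (ler_normD _ _))// lerD//.
    exact: (slope_refine flat IHk).
  have hA : 0 <= A * sigma ^+ k by rewrite mulr_ge0.
  have hAB : 0 <= A * B k * sigma ^+ k by rewrite !mulr_ge0.
  have hC : 0 <= C * sigma ^+ k by rewrite mulr_ge0.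
  have [j [->|->]] : exists j : int, i = 2 * j \/ i = 2 * j + 1.
    exact: int_even_or_odd.
    by apply: (le_trans (even j)); rewrite /c; lra.
  have -> : slope p k.+1 (2 * j + 1) =
      edge (slope p k.+1) (2 * j) + slope p k.+1 (2 * j) by rewrite subrK.
  apply: (le_trans (ler_normD _ _)).
  apply: (le_trans (lerD (slope_adjacent flat _ _) (even j))).
  have : A * sigma ^+ k.+1 <= A * sigma ^+ k.
    by rewrite ler_wpM2l// exprS ler_piMl// ltW.
  by rewrite /c; lra.
exists ((d + 1) * expR (c / (1 - sigma))) => k i.
apply: (le_trans (pB k i)).
rewrite /B lerBlDr -[leLHS]addr0 lerD// ler_wpM2l ?addr_ge0//.
rewrite ler_expR ler_wpM2r ?invr_ge0 ?(ltW os)// ler_piMr//.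
by rewrite gerBl exprn_ge0// ltW.
Qed.

(** * Piecewise linear interpolation *)

(** With the integers as knots, the index of the interval of the interpolant
    that contains [u]. *)
Definition cell (R : realType) (u : R) : int := Num.floor u.

Lemma cell_le (R : realType) (u : R) : (cell u)%:~R <= u.
Proof. exact: ge_floor. Qed.

Lemma lt_cellD1 (R : realType) (u : R) : u < (cell u + 1)%:~R.
Proof. exact: floorD1_gt. Qed.

Lemma cell_ge_int (R : realType) (u : R) (j : int) : (j <= cell u) = (j%:~R <= u).
Proof. exact: floor_ge_int. Qed.

Lemma cell_int (R : realType) (j : int) : cell (j%:~R : R) = j.
Proof. exact: intrKfloor. Qed.

(** The interpolant is evaluated in the coordinate in which the knots are the
    integers, so that one function serves all levels and both parametrizations;
    level [k] is [fun x => pl (p k) (2 ^+ k * (x - tau k))] where [tau k] is the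
    position of the knot of index 0. *)
Definition pl (R : realType) (V : normedModType R) (p : int -> V) (u : R) : V :=
  p (cell u) + (u - (cell u)%:~R) *: edge p (cell u).

Lemma pl_segment (R : realType) (V : normedModType R) (p : int -> V) (j : int)
    (u : R) :
  j%:~R <= u <= (j + 1)%:~R -> pl p u = p j + (u - j%:~R) *: edge p j.
Proof.
case/andP=> ju; rewrite le_eqVlt => /predU1P[->|uj].
  rewrite /pl cell_int subrr scale0r addr0.
  by rewrite intrD addrAC subrr add0r scale1r /edge [RHS]addrC subrK.
by rewrite /pl /cell (@floor_def _ u j) // ju.
Qed.

(** On each cell the increment is exactly proportional to the edge, and the
    estimate adds up along the cells that the segment from [a] to [b] crosses. *)
Lemma pl_mean_value (R : realType) (V : normedModType R) (p : int -> V) (w : V)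
    (B a b : R) :
  a <= b ->
  (forall i, cell a <= i <= cell b -> `|edge p i - w| <= B) ->
  `|pl p b - pl p a - (b - a) *: w| <= (b - a) * B.
Proof.
have segment (j : int) (x y : R) : x <= y -> `|edge p j - w| <= B ->
    j%:~R <= x -> y <= (j + 1)%:~R ->
    `|pl p y - pl p x - (y - x) *: w| <= (y - x) * B.
  move=> xy ew jx yj.
  rewrite !(@pl_segment _ _ p j) ?jx ?yj ?(le_trans jx) ?(le_trans xy)//.
  rewrite opprD addrACA subrr add0r -scalerBl opprB addrA subrK -scalerBr.
  by rewrite normrZ ger0_norm ?subr_ge0// ler_wpM2l// subr_ge0.
have [n] : exists n : nat, cell b <= cell a + n%:Z.
  by exists `|cell b - cell a|%N; lia.
elim: n a => [|n IHn] a ab_n ab ew.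
  have fab : cell b = cell a.
    have : cell a <= cell b by rewrite cell_ge_int (le_trans (cell_le a)).
    by lia.
  apply: (segment (cell a)) => //.
  - by apply: ew; rewrite fab lexx.
  - exact: cell_le.
  - by rewrite -fab ltW// lt_cellD1.
have ea : `|edge p (cell a) - w| <= B.
  by apply: ew; rewrite lexx cell_ge_int (le_trans (cell_le a)).
set c : R := (cell a + 1)%:~R.
have fc : cell c = cell a + 1 by rewrite cell_int.
have [bc|cb] := leP b c.
  by apply: (segment (cell a)) => //; exact: cell_le.
have -> : pl p b - pl p a - (b - a) *: w =
    (pl p b - pl p c - (b - c) *: w) + (pl p c - pl p a - (c - a) *: w).
  by rewrite addrACA subrKA -opprD -scalerDl subrKA.
have -> : (b - a) * B = (b - c) * B + (c - a) * B by ring.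
apply: (le_trans (ler_normD _ _)); apply: lerD.
- apply: IHn; [by rewrite fc; lia|exact: ltW|].
  by move=> i; rewrite fc => /andP[i1 i2]; apply: ew; rewrite i2 andbT; lia.
- apply: (segment (cell a)) => //; last exact: cell_le.
  by rewrite ltW// lt_cellD1.
Qed.

Lemma pl_lipschitz (R : realType) (V : normedModType R) (p : int -> V) (d : R) :
  (forall i, `|edge p i| <= d) ->
  forall a b, `|pl p b - pl p a| <= `|b - a| * d.
Proof.
move=> pd a b; wlog ab : a b / a <= b.
  move=> H; have [/H//|/ltW/H] := leP a b.
  by rewrite distrC [`|a - b|]distrC.
rewrite (ger0_norm (_ : 0 <= b - a)) ?subr_ge0//.
have := @pl_mean_value _ _ p 0 d a b ab; rewrite scaler0 subr0; apply.
by move=> i _; rewrite subr0.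
Qed.

(** * The limit function and its derivative *)
Lemma geometric_limit (R : realType) (V : completeNormedModType R) (u : nat -> V)
    (K q : R) :
  0 < q < 1 -> (forall k, `|u k.+1 - u k| <= K * q ^+ k) ->
  exists l : V, forall k, `|u k - l| <= K / (1 - q) * q ^+ k.
Proof.
move=> /andP[q0 q1] uK.
have K0 : 0 <= K by have := le_trans (normr_ge0 _) (uK 0); rewrite expr0 mulr1.
have q1' : 0 < 1 - q by rewrite subr_gt0.
have tail k m : `|u (k + m)%N - u k| <= K / (1 - q) * q ^+ k.
  have : `|u (k + m)%N - u k| <= K / (1 - q) * (q ^+ k - q ^+ (k + m)).
    elim: m => [|m IHm]; first by rewrite addn0 !subrr normr0 mulr0.
    rewrite addnS -(subrKA (u (k + m)%N)).
    apply: (le_trans (ler_normD _ _)).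
    apply: (le_trans (lerD (uK _) IHm)).
    rewrite exprS le_eqVlt; apply/orP; left; apply/eqP; field.
    by rewrite gt_eqF.
  move/le_trans; apply; rewrite ler_wpM2l ?divr_ge0 ?(ltW q1')//.
  by rewrite gerBl exprn_ge0// ltW.
have cu : cvgn u.
  have : cvgn (series (fun k => u k.+1 - u k)).
    apply: normed_cvg.
    apply: (@series_le_cvg _ _ (fun k => K * q ^+ k)) => //.
    - by move=> n; exact: normr_ge0.
    - by move=> n /=; rewrite mulr_ge0// exprn_ge0// ltW.
    - by apply: is_cvg_geometric_series; rewrite gtr0_norm.
  have uE : u = (fun n => series (fun k => u k.+1 - u k) n + u 0%N).
    by apply/funext => n; rewrite /series/= telescope_sumr// subrK.
  by move=> cs; rewrite uE; apply: is_cvgD => //; exact: is_cvg_cst.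
exists (limn u) => k; apply/ler_addgt0Pr => e e0.
have /cvgrPdist_le/(_ e e0)[n _ nu] := cu.
have := nu (k + n)%N (leq_addl _ _) => /= h.
have -> : u k - limn u = (u k - u (k + n)%N) + (u (k + n)%N - limn u).
  by rewrite subrKA.
apply: (le_trans (ler_normD _ _)); apply: lerD; rewrite distrC.
  exact: tail.
exact: h.
Qed.

Lemma pl_int (R : realType) (V : normedModType R) (p : int -> V) (j : int) :
  pl p j%:~R = p j.
Proof. by rewrite /pl cell_int subrr scale0r addr0. Qed.

Lemma edge_le_slope (R : realType) (V : normedModType R)
    (p : nat -> int -> V) (d : R) (k : nat) :
  (forall i, `|slope p k i| <= d) ->
  forall i, `|edge (p k) i| <= d * 2^-1 ^+ k.
Proof.
move=> pd i; have := pd i.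
rewrite /slope normrZ gtr0_norm ?exprn_gt0// exprVn => h.
by rewrite ler_pdivlMr ?exprn_gt0// mulrC.
Qed.

(** [u] and [u'] are coordinates of one real number at levels [k] and [k + 1]:
    [u' = 2 * u] for the primal knots and [u' = 2 * u - 1 / 2] for the dual ones.
    The cell of [u'] is therefore within one of twice the cell of [u], and
    [slope_refine] applies up to one adjacent slope. *)
Lemma slope_level_change (R : realType) (V : normedModType R)
    (p : nat -> int -> V) (C A sigma d : R) :
  flattening_levels p C A sigma ->
  (forall k i, `|slope p k i| <= d) ->
  forall (k : nat) (u u' : R), 2 * u - 1 <= u' <= 2 * u ->
    `|slope p k.+1 (cell u') - slope p k (cell u)|
      <= (7 * A + 2 * C * d) * sigma ^+ k.
Proof.
move=> flat pd k u u' /andP[u1 u2].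
have [_ A0 /andP[s0 s1] _ _ _] := flat.
rewrite -(subrKA (slope p k.+1 (2 * cell u))).
apply: (le_trans (ler_normD _ _)).
have -> : (7 * A + 2 * C * d) * sigma ^+ k =
  A * sigma ^+ k + (6 * A + 2 * C * d) * sigma ^+ k by ring.
apply: lerD; last exact: (slope_refine flat (pd k)).
apply: (le_trans (norm_dist_le (slope_adjacent flat k.+1) _ _)).
have Ask : A * sigma ^+ k.+1 <= A * sigma ^+ k.
  by rewrite ler_wpM2l// exprS ler_piMl ?exprn_ge0// ltW.
apply: le_trans Ask; rewrite ler_piMl//.
  by rewrite mulr_ge0// exprn_ge0// ltW.
rewrite -[1]/(1%:~R) ler_int.
have h1 : 2 * cell u - 1 <= cell u'.
  rewrite cell_ge_int (le_trans _ u1)// rmorphB rmorphM/= lerB// ler_wpM2l//.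
  exact: cell_le.
have h2 : cell u' < 2 * cell u + 2.
  rewrite ltNge cell_ge_int -ltNge (le_lt_trans u2)//.
  rewrite (_ : 2 * cell u + 2 = 2 * (cell u + 1)); last lia.
  by rewrite rmorphM/= ltr_pM2l// lt_cellD1.
lia.
Qed.

(** Go from [u'] to the even knot [2 * cell u], from the point there to the point
    of [p k] that it displaces, and from that one to [u].  Each move costs a bounded
    multiple of the longest edge, which is at most [d * 2^-1 ^+ k]. *)
Lemma pl_level_change (R : realType) (V : normedModType R)
    (p : nat -> int -> V) (C A sigma d : R) :
  flattening_levels p C A sigma ->
  (forall k i, `|slope p k i| <= d) ->
  forall (k : nat) (u u' : R), 2 * u - 1 <= u' <= 2 * u ->
    `|pl (p k.+1) u' - pl (p k) u| <= (2 + C) * d * 2^-1 ^+ k.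
Proof.
move=> flat pd k u u' /andP[u1 u2].
have [_ _ _ _ pdis _] := flat.
have d0 : 0 <= d by rewrite (le_trans _ (pd 0%N 0)).
have := edge_le_slope (pd k); set dk := d * _ => ek.
have := edge_le_slope (pd k.+1).
have -> : d * 2^-1 ^+ k.+1 = dk / 2 by rewrite exprSr mulrA.
move=> ek1; have dk0 : 0 <= dk by rewrite (le_trans _ (ek 0)).
have c1 := cell_le u; have := lt_cellD1 u; rewrite intrD => c2.
set J := cell u in c1 c2.
have -> : pl (p k.+1) u' - pl (p k) u =
   (pl (p k.+1) u' - pl (p k.+1) (2 * J)%:~R)
   + (p k.+1 (2 * J) - p k J) + (pl (p k) J%:~R - pl (p k) u).
  by rewrite !pl_int !subrKA.
have b1 := pl_lipschitz ek1 (2 * J)%:~R u'.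
have b3 := pl_lipschitz ek u J%:~R.
have b2 := pdis k dk ek J.
have l1 : `|u' - (2 * J)%:~R| <= 2.
  by rewrite rmorphM/= ler_norml; apply/andP; split; lra.
have l3 : `|J%:~R - u| <= 1.
  by rewrite ler_norml; apply/andP; split; lra.
have -> : (2 + C) * d * 2^-1 ^+ k = 2 * (dk / 2) + C * dk + 1 * dk.
  by rewrite -mulrA -/dk; field.
apply: (le_trans (ler_normD _ _)); apply: lerD.
  apply: (le_trans (ler_normD _ _)); apply: lerD => //.
  by apply: (le_trans b1); rewrite ler_wpM2r// divr_ge0.
by apply: (le_trans b3); rewrite ler_wpM2r.
Qed.

Lemma geometric_small (R : realType) (a q e : R) : 0 < q < 1 -> 0 < e ->
  exists N : nat, forall k, (N <= k)%N -> a * q ^+ k <= e.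
Proof.
move=> /andP[q0 q1] e0.
have q1' : `|q| < 1 by rewrite gtr0_norm.
have /cvgrPdist_le/(_ e e0)[N _ h] := cvg_geometric a q1'.
exists N => k Nk; have := h k Nk => /=.
by rewrite sub0r normrN; apply: le_trans; exact: ler_norm.
Qed.

(** [pl_mean_value] at level [k], with the slopes of level [k] replaced by the
    nearby values of [S], in the limit of large [k].  The comparison vector [w] is
    arbitrary so that the lemma applies with [w] the value of [S] at either end
    of the interval. *)
Lemma limit_mean_value (R : realType) (V : normedModType R)
    (p : nat -> int -> V) (tau : nat -> R) (Q S : R -> V) (K K' sigma : R) :
  0 < sigma < 1 ->
  (forall k x, `|pl (p k) (2 ^+ k * (x - tau k)) - Q x| <= K * 2^-1 ^+ k) ->
  (forall k x, `|slope p k (cell (2 ^+ k * (x - tau k))) - S x|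
     <= K' * sigma ^+ k) ->
  forall (w : V) (omega x y : R), x <= y ->
    (forall z, x <= z <= y -> `|S z - w| <= omega) ->
    `|Q y - Q x - (y - x) *: w| <= (y - x) * omega.
Proof.
move=> s01 QK SK w omega x y xy Sw; apply/ler_addgt0Pr => e e0.
have half : 0 < (2^-1 : R) < 1 by apply/andP; split; lra.
have e2 : 0 < e / 2 by rewrite divr_gt0.
have [N1 small1] := geometric_small ((y - x) * K') s01 e2.
have [N2 small2] := geometric_small (2 * K) half e2.
pose k := maxn N1 N2.
have {small1}small1 := small1 k (leq_maxl _ _).
have {small2}small2 := small2 k (leq_maxr _ _).
have t0 : 0 < 2 ^+ k :> R by rewrite exprn_gt0.
set a := 2 ^+ k * (x - tau k); set b := 2 ^+ k * (y - tau k).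
have ab : a <= b by rewrite ler_pM2l// lerB.
have baE : b - a = 2 ^+ k * (y - x) by rewrite /a /b; ring.
have edge_near i : cell a <= i <= cell b ->
    `|edge (p k) i - 2 ^- k *: w| <= 2 ^- k * (omega + K' * sigma ^+ k).
  move=> /andP[ai ib].
  have -> : edge (p k) i - 2 ^- k *: w = 2 ^- k *: (slope p k i - w).
    by rewrite [RHS]scalerBr /slope scalerA mulVf ?gt_eqF// scale1r.
  rewrite normrZ gtr0_norm ?invr_gt0// ler_pM2l ?invr_gt0//.
  (* The slope of index [i] is a value of the step function at some [z] between
     [x] and [y]: at [x] itself for the first cell, at the left knot otherwise. *)
  have [z /andP[xz zy] iE] : exists2 z, x <= z <= y &
      i = cell (2 ^+ k * (z - tau k)).
    have [ia|ia] := eqVneq i (cell a); first by exists x; rewrite ?lexx.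
    pose z := i%:~R / 2 ^+ k + tau k.
    have zE : 2 ^+ k * (z - tau k) = i%:~R.
      by rewrite /z addrK mulrCA divff ?gt_eqF// mulr1.
    exists z; last by rewrite zE cell_int.
    have xzy : a <= i%:~R <= b.
      rewrite -cell_ge_int ib andbT.
      rewrite (le_trans (ltW (lt_cellD1 a)))//.
      by rewrite ler_int lezD1 lt_neqAle eq_sym ia.
    by move: xzy; rewrite -zE /a /b !ler_pM2l// !lerD2r.
  rewrite iE -(subrKA (S z)) (le_trans (ler_normD _ _))// addrC.
  by apply: lerD; [apply: Sw; rewrite xz|apply: SK].
have := pl_mean_value ab edge_near; rewrite baE scalerA mulrACA divff ?gt_eqF//.
rewrite mulrAC divff ?gt_eqF// !mul1r => mv.
have -> : Q y - Q x - (y - x) *: w =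
   (pl (p k) b - pl (p k) a - (y - x) *: w)
   + ((pl (p k) a - Q x) - (pl (p k) b - Q y)).
  set A := pl _ b; set B := pl _ a; set W := _ *: w.
  rewrite opprB [B - _ + _]addrC addrCA [A - B - W]addrAC subrKA.
  by rewrite -[A - W - _]addrA subrKA addrA [RHS]addrAC.
apply: (le_trans (ler_normD _ _)).
apply: (le_trans (lerD mv (ler_normB _ _))).
have := QK k x; have := QK k y; rewrite -/a -/b.
by move: small1 small2; lra.
Qed.

Lemma derive1_of_expansion (R : realType) (V : normedModType R) (Q : R -> V)
    (x : R) (l : V) :
  (forall e : R, 0 < e -> exists2 r : R, 0 < r &
     forall y, `|y - x| < r -> `|Q y - Q x - (y - x) *: l| <= e * `|y - x|) ->
  derivable Q x 1 /\ derive1 Q x = l.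
Proof.
move=> Ql.
suff cl :
    (fun h : R => h^-1 *: ((Q \o shift x) (h *: (1 : R)) - Q x)) @ 0^' --> l.
  by split; [apply/cvg_ex; exists l|rewrite derive1E; exact/cvg_lim].
apply/cvgrPdist_le => e e0; have [r r0 Qr] := Ql e e0.
near=> h.
have h0 : h != 0 by near: h; exact: nbhs_dnbhs_neq.
have hr : `|h| < r by near: h; exact: dnbhs0_lt.
rewrite /= distrC [h *: _]mulr1.
have := Qr (h + x); rewrite addrK => /(_ hr) hQ.
rewrite -[l](scalerK h0) -scalerBr normrZ normfV ler_pdivrMl ?normr_gt0//.
by rewrite mulrC.
Unshelve. all: by end_near. Qed.

(** At a level [k] chosen by [e], points closer than [2 ^- k] have cells at most
    two apart, hence slopes within [2 * A * sigma ^+ k]. *)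
Lemma limit_slope_equicontinuous (R : realType) (V : normedModType R)
    (p : nat -> int -> V) (tau : nat -> R) (S : R -> V) (C A K' sigma : R) :
  flattening_levels p C A sigma ->
  (forall k x, `|slope p k (cell (2 ^+ k * (x - tau k))) - S x|
     <= K' * sigma ^+ k) ->
  forall e : R, 0 < e -> exists2 r : R, 0 < r &
    forall x y, `|y - x| < r -> `|S y - S x| <= e.
Proof.
move=> flat SK e e0; have [_ A0 s01 _ _ _] := flat.
have [k /(_ k (leqnn k)) small] := geometric_small (2 * K' + 2 * A) s01 e0.
have t0 : 0 < 2 ^+ k :> R by rewrite exprn_gt0.
exists (2 ^- k); first by rewrite invr_gt0.
move=> x y; rewrite -(ltr_pM2l t0) divff ?gt_eqF// -[X in X * `|_|]gtr0_norm//.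
rewrite -normrM.
have -> : 2 ^+ k * (y - x) = 2 ^+ k * (y - tau k) - 2 ^+ k * (x - tau k) by ring.
set u := 2 ^+ k * (y - _); set v := 2 ^+ k * (x - _); rewrite ltr_norml => uv.
have cells : `|cell u - cell v|%:~R <= 2 :> R.
  have := cell_le u; have := cell_le v; have := lt_cellD1 u; have := lt_cellD1 v.
  rewrite !intrD intr_norm rmorphB/= => h1 h2 h3 h4.
  by rewrite ler_norml; apply/andP; split; lra.
have near_slopes :
    `|slope p k (cell u) - slope p k (cell v)| <= 2 * (A * sigma ^+ k).
  apply: (le_trans (norm_dist_le (slope_adjacent flat k) _ _)).
  rewrite ler_wpM2r// mulr_ge0// exprn_ge0//.
  by case/andP: s01 => /ltW.
have -> : S y - S x = (S y - slope p k (cell u))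
    + (slope p k (cell u) - slope p k (cell v)) + (slope p k (cell v) - S x).
  by rewrite !subrKA.
have := SK k x; have := SK k y.
rewrite -/u -/v [`|slope _ _ _ - S y|]distrC => hy hx.
apply: (le_trans (ler_normD _ _)).
apply: (le_trans (lerD (ler_normD _ _) (lexx _))).
by move: small; rewrite mulrDl; lra.
Qed.

(** The hypothesis on [tau] says that refinement shifts the knots to the right,
    by at most one step of the finer level. *)
Lemma flattening_levels_C1 (R : realType) (V : completeNormedModType R)
    (p : nat -> int -> V) (tau : nat -> R) (C A sigma : R) :
  flattening_levels p C A sigma ->
  (forall k, 0 <= 2 ^+ k.+1 * (tau k.+1 - tau k) <= 1) ->
  exists Q : R -> V,
    (exists K : R, forall k x,
      `|pl (p k) (2 ^+ k * (x - tau k)) - Q x| <= K * 2^-1 ^+ k) /\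
    ((forall x, derivable Q x 1) /\ continuous (derive1 Q)).
Proof.
move=> flat tau1; have [_ _ s01 _ _ _] := flat.
have [d pd] := slope_bounded flat.
have half : 0 < (2^-1 : R) < 1 by apply/andP; split; lra.
have chart k x : 2 * (2 ^+ k * (x - tau k)) - 1 <= 2 ^+ k.+1 * (x - tau k.+1)
    <= 2 * (2 ^+ k * (x - tau k)).
  have := tau1 k; rewrite exprS => /andP[h1 h2].
  by apply/andP; split; lra.
have lim_pl x := @geometric_limit _ _ (fun k => pl (p k) (2 ^+ k * (x - tau k)))
  _ _ half (fun k => pl_level_change flat pd k (chart k x)).
have [Q QK] := choice lim_pl.
have lim_slope x := @geometric_limit _ _
  (fun k => slope p k (cell (2 ^+ k * (x - tau k))))
  _ _ s01 (fun k => slope_level_change flat pd k (chart k x)).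
have [S SK] := choice lim_slope.
have S_equi := limit_slope_equicontinuous flat (fun k x => SK x k).
have Qmv := limit_mean_value s01 (fun k x => QK x k) (fun k x => SK x k).
have QS x : derivable Q x 1 /\ derive1 Q x = S x.
  apply: derive1_of_expansion => e e0; have [r r0 Sr] := S_equi e e0.
  exists r => // y yx; have [xy|yx'] := leP x y.
    rewrite mulrC (ger0_norm (_ : 0 <= y - x)) ?subr_ge0//.
    apply: Qmv => // z /andP[xz zy]; apply: Sr.
    move: yx; rewrite !ger0_norm ?subr_ge0//.
    by apply: le_lt_trans; rewrite lerB.
  (* [limit_mean_value] is oriented; for [y < x] it is used from [y] to [x]. *)
  have -> : Q y - Q x - (y - x) *: S x = - (Q x - Q y - (x - y) *: S x).
    by rewrite [RHS]opprB [in RHS]opprB -scaleNr opprB [LHS]addrC.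
  have -> : `|y - x| = x - y by rewrite distrC ger0_norm// subr_ge0 ltW.
  rewrite normrN mulrC.
  apply: Qmv => [|z /andP[yz zx]]; first exact: ltW.
  apply: Sr; move: yx; rewrite distrC [`|z - x|]distrC.
  rewrite !ger0_norm ?subr_ge0// ?(ltW yx')//.
  by apply: le_lt_trans; rewrite lerB.
exists Q; split; first by eexists => k x; exact: QK.
split=> x; first by have [] := QS x.
rewrite (_ : derive1 Q = S); last by apply/funext => y; have [] := QS y.
apply/cvgrPdist_le => e e0; have [r r0 Sr] := S_equi e e0.
near=> y; rewrite distrC; apply: Sr.
by rewrite distrC; near: y; exact: cvgr_dist_lt.
Unshelve. all: by end_near. Qed.

(** * Equivalence of norms *)
Lemma is_norm0 (R : realType) (n : nat) (N : 'rV[R]_n -> R) :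
  is_norm N -> N 0 = 0.
Proof. by move=> nN; rewrite -(scale0r 0) (norm_homogeneous nN) normr0 mul0r. Qed.

Lemma is_normN (R : realType) (n : nat) (N : 'rV[R]_n -> R) :
  is_norm N -> forall x, N (- x) = N x.
Proof.
by move=> nN x; rewrite -scaleN1r (norm_homogeneous nN) normrN normr1 mul1r.
Qed.

Lemma is_norm_ge0 (R : realType) (n : nat) (N : 'rV[R]_n -> R) :
  is_norm N -> forall x, 0 <= N x.
Proof.
move=> nN x; have := norm_triangle nN x (- x).
by rewrite subrr (is_norm0 nN) (is_normN nN); lra.
Qed.

Lemma is_norm_sub (R : realType) (n : nat) (N : 'rV[R]_n -> R) :
  is_norm N -> forall x y, N (x - y) <= N x + N y.
Proof.
by move=> nN x y; rewrite -[N y](is_normN nN); exact: norm_triangle.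
Qed.

Lemma coord_le_norm (R : realType) (n : nat) (x : 'rV[R]_n) (i : 'I_n) :
  `|x ord0 i| <= `|x|.
Proof.
rewrite [leRHS]/Num.norm/= mx_normrE.
by apply/bigmax_geP; right; exists (ord0, i).
Qed.

Lemma is_norm_le (R : realType) (n : nat) (N : 'rV[R]_n -> R) :
  is_norm N -> exists2 K : R, 0 < K & forall x, N x <= K * `|x|.
Proof.
move=> nN; exists (1 + \sum_(i < n) N (delta_mx ord0 i)).
  by rewrite ltr_pwDl// sumr_ge0// => i _; exact: is_norm_ge0.
move=> x; apply: (@le_trans _ _ (\sum_(i < n) `|x| * N (delta_mx ord0 i))).
  rewrite [in leLHS](row_sum_delta x).
  apply: (@le_trans _ _ (\sum_(i < n) N (x ord0 i *: delta_mx ord0 i))).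
    elim/big_ind2 : _ => [|y a z b ya zb|//]; first by rewrite (is_norm0 nN).
    by rewrite (le_trans (norm_triangle nN _ _))// lerD.
  apply: ler_sum => i _; rewrite (norm_homogeneous nN).
  by rewrite ler_wpM2r ?coord_le_norm// is_norm_ge0.
by rewrite -mulr_sumr mulrDl mul1r [leLHS]mulrC lerDr.
Qed.

Lemma is_norm_continuous (R : realType) (n : nat) (N : 'rV[R]_n -> R) :
  is_norm N -> continuous N.
Proof.
move=> nN x; have [K K0 NK] := is_norm_le nN.
apply/(@cvgrPdist_lt _ _ _ (nbhs x)) => e e0; near=> y.
have h : N (x - y) < e.
  apply: (le_lt_trans (NK _)); rewrite -ltr_pdivlMl//.
  by near: y; apply: cvgr_dist_lt => //; rewrite mulr_gt0 ?invr_gt0.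
have h1 : N x <= N (x - y) + N y by rewrite -[x in N x](subrK y) norm_triangle.
have h2 : N y <= N (x - y) + N x.
  by rewrite -[N (x - y)](is_normN nN) opprB -[y in N y](subrK x) norm_triangle.
by rewrite ltr_norml; apply/andP; split; lra.
Unshelve. all: by end_near. Qed.

(** [N] does not vanish on the unit sphere, whose image under [N] is compact,
    hence closed; so this image avoids a ball around 0. *)
Lemma is_norm_ge (R : realType) (n : nat) (N : 'rV[R]_n -> R) :
  is_norm N -> exists2 K : R, 0 < K & forall x : 'rV[R]_n, `|x| <= K * N x.
Proof.
move=> nN; pose sphere := [set x : 'rV[R]_n | `|x| = 1].
have sphere_compact : compact sphere.
  apply: bounded_closed_compact.
    by exists 1; split => // M M1 x /= ->; exact: ltW.
  apply: (@closed_comp _ _ (fun x : 'rV[R]_n => `|x|) [set 1]) => //.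
    by move=> x _; exact: norm_continuous.
have image_closed : closed (N @` sphere).
  apply: compact_closed; first exact: Rhausdorff.
  apply: continuous_compact => //.
  by apply: continuous_subspaceT; exact: is_norm_continuous.
have : ~ (N @` sphere) 0.
  move=> [x x1 /(norm_definite nN) x0]; have : `|x| = 1 := x1.
  by rewrite x0 normr0 => /eqP; rewrite eq_sym oner_eq0.
rewrite -[~ _]/((~` (N @` sphere)) 0) => N0.
have /nbhs_ballP[e /= e0 eN] : nbhs (0 : R) (~` (N @` sphere)).
  by apply: open_nbhs_nbhs; split=> //; exact: closed_openC.
exists e^-1; first by rewrite invr_gt0.
move=> x; have [->|x0] := eqVneq x 0; first by rewrite normr0 (is_norm0 nN) mulr0.
have nx : 0 < `|x| by rewrite normr_gt0.
rewrite ler_pdivlMl// leNgt; apply/negP => Nx.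
apply: (eN (N (`|x|^-1 *: x))).
  rewrite /ball/= sub0r normrN ger0_norm ?is_norm_ge0//.
  by rewrite (norm_homogeneous nN) gtr0_norm ?invr_gt0// ltr_pdivrMl// mulrC.
have unit_x : `|(`|x|^-1 *: x)| = 1.
  by rewrite normrZ gtr0_norm ?invr_gt0// mulVf ?gt_eqF.
by exists (`|x|^-1 *: x).
Qed.

(** Real matrices are complete as a uniform space and normed as a module; the
    join of the two structures makes them a complete normed module. *)
HB.instance Definition _ (R : realType) (m n : nat) :=
  Complete.copy 'M[R]_(m, n) 'M[R]_(m, n).

(** * Decay of the second differences *)
Lemma delta_le (R : realType) (n : nat) (N : 'rV[R]_n -> R)
    (P : int -> 'rV[R]_n) (c : R) :
  (delta N P <= c%:E)%E <-> (forall j, N (edge P j) <= c).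
Proof.
split=> [Pc j|Pc].
  rewrite -lee_fin; apply: le_trans Pc; apply: ereal_sup_ubound.
  by exists j.
apply: ge_ereal_sup => _ [j _ <-]. by rewrite lee_fin; exact: Pc.
Qed.

Lemma delta_finite (R : realType) (n : nat) (N : 'rV[R]_n -> R)
    (P : int -> 'rV[R]_n) :
  (delta N P < +oo)%E -> exists c : R, forall j, N (edge P j) <= c.
Proof.
move=> fin; case E : (delta N P) fin => [c| |] // _.
  by exists c; apply/delta_le; rewrite E.
by exists 0; apply/delta_le; rewrite E leNye.
Qed.

(** Contractivity holds for the same [P] at all levels, and its two sides scale
    by the same factor, so level 0 already contains all its information. *)
Lemma contractive_second_edge (R : realType) (n : nat) (N : 'rV[R]_n -> R)
    (D : set (int -> 'rV[R]_n)) (S : scheme R n) (mu : R) (L : nat) :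
  is_norm N -> 0 <= mu -> first_order_contractive N D S mu L ->
  forall (P : int -> 'rV[R]_n) (c : R), D P ->
    (forall i, N (edge (edge P) i) <= c) ->
    forall i, N (edge (edge (iter L S P)) i) <= mu * 2 ^- L * c.
Proof.
move=> nN mu0 contr P c DP Pc i.
have fddE k (P' : int -> 'rV[R]_n) j :
    edge (first_divided_diff k P') j = 2 ^+ k *: edge (edge P') j.
  by rewrite /first_divided_diff invrK [in RHS]/edge scalerBr.
have hP : (delta N (first_divided_diff 0 P) <= c%:E)%E.
  by apply/delta_le => j; rewrite fddE expr0 scale1r.
have : (delta N (first_divided_diff L (iter L S P)) <= (mu * c)%:E)%E.
  apply: (le_trans (contr 0%N P DP)); rewrite EFinM.
  by apply: lee_wpmul2l.
move=> /delta_le/(_ i); rewrite fddE (norm_homogeneous nN) gtr0_norm ?exprn_gt0//.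
by rewrite [mu / _ * c]mulrAC ler_pdivlMr ?exprn_gt0// mulrC.
Qed.

(** A contraction by [lambda] perturbed by a term in [eta ^+ j.+1] decays like any
    [beta] beyond both rates, with a strict gap above [lambda] that absorbs the
    perturbation into [A]. *)
Lemma geometric_recursion (R : realType) (s : nat -> int -> R)
    (lambda eta E beta c : R) :
  0 <= lambda < beta -> 0 < eta <= beta -> 0 <= E ->
  (forall i, s 0%N i <= c) ->
  (forall j b, (forall i, s j i <= b) ->
     forall i, s j.+1 i <= lambda * b + E * eta ^+ j.+1) ->
  exists A : R, forall j i, s j i <= A * beta ^+ j.
Proof.
move=> /andP[l0 lb] /andP[e0 eb] E0 s0 sS.
have bl : 0 < beta - lambda by rewrite subr_gt0.
have b0 : 0 < beta by exact: lt_le_trans eb.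
(* Inductive step: [lambda * A + E * eta <= beta * A]. *)
pose A := `|c| + E * eta / (beta - lambda).
have A1 : E * eta <= A * (beta - lambda).
  by rewrite mulrDl divfK ?gt_eqF// lerDr mulr_ge0// ltW.
exists A; elim=> [|j IHj] i.
  rewrite expr0 mulr1; apply: (le_trans (s0 i)); apply: (le_trans (ler_norm c)).
  by rewrite lerDl divr_ge0 ?mulr_ge0// ltW.
apply: (le_trans (sS j _ IHj i)).
have ebj : eta ^+ j <= beta ^+ j by rewrite lerXn2r ?nnegrE// ltW.
have h1 : E * eta * eta ^+ j <= E * eta * beta ^+ j.
  by rewrite ler_wpM2l// mulr_ge0// ltW.
have h2 : E * eta * beta ^+ j <= A * (beta - lambda) * beta ^+ j.
  by rewrite ler_wpM2r// exprn_ge0// ltW.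
by rewrite !exprS; lra.
Qed.

(** By Bernoulli's inequality: [1 - (1 - r) / n.+1] is such a [q]. *)
Lemma exists_large_power (R : realType) (r : R) (n : nat) :
  0 < r < 1 -> exists2 q : R, 0 < q < 1 & r < q ^+ n.
Proof.
move=> /andP[r0 r1].
have bernoulli (x : R) m : 0 <= x <= 1 -> 1 - m%:R * x <= (1 - x) ^+ m.
  move=> /andP[x0 x1]; elim: m => [|m IHm]; first by rewrite mul0r subr0 expr0.
  rewrite exprS; apply: (@le_trans _ _ ((1 - x) * (1 - m%:R * x))).
    have -> : (1 - x) * (1 - m%:R * x) = 1 - m.+1%:R * x + m%:R * x * x.
      by rewrite -natr1; ring.
    by rewrite lerDl !mulr_ge0.
  by rewrite ler_wpM2l// subr_ge0.
have n0 : 0 < n.+1%:R :> R by rewrite ltr0n.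
have n1 : n%:R / n.+1%:R < 1 :> R by rewrite ltr_pdivrMr// mul1r ltr_nat.
pose x := (1 - r) / n.+1%:R.
have x0 : 0 < x by rewrite divr_gt0// subr_gt0.
have x1 : x < 1.
  rewrite ltr_pdivrMr// mul1r (@lt_le_trans _ _ 1)//; first by lra.
  by rewrite ler1n.
exists (1 - x); first by apply/andP; split; lra.
apply: (@lt_le_trans _ _ (1 - n%:R * x)).
  have -> : n%:R * x = (1 - r) * (n%:R / n.+1%:R) by rewrite /x mulrCA mulrA.
  have : (1 - r) * (n%:R / n.+1%:R) < (1 - r) * 1 by rewrite ltr_pM2l// subr_gt0.
  by set y := _ * (_ / _); lra.
by apply: bernoulli; apply/andP; split; exact: ltW.
Qed.

Lemma iter_stable (T : Type) (D : set T) (S : T -> T) :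
  (forall x, D x -> D (S x)) -> forall k x, D x -> D (iter k S x).
Proof. by move=> DS; elim=> [//|k IHk] x Dx /=; exact/DS/IHk. Qed.

Lemma edgeD (V : zmodType) (f g : int -> V) :
  edge (f \+ g) = edge f \+ edge g.
Proof. by apply/funext => i; rewrite /edge /= opprD addrACA. Qed.

(** One step of [S1^L] is one step of [S2^L], which multiplies second differences
    by [mu / 2^L], plus a perturbation whose second differences are at most four
    times the proximity bound. *)
Lemma second_edge_decay_block (R : realType) (n : nat) (N : 'rV[R]_n -> R)
    (D : set (int -> 'rV[R]_n)) (S1 S2 : scheme R n) (mu eta beta : R) (L : nat) :
  is_norm N ->
  (forall P, D P -> (delta N P < +oo)%E) ->
  (forall P, D P -> D (S1 P)) ->
  first_order_contractive N D S2 mu L ->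
  second_type_proximity N D S1 S2 L 1 eta ->
  0 <= mu -> mu * 2 ^- L < beta -> eta <= beta ->
  forall P, D P -> exists A : R, forall j i,
    N (edge (edge (iter (j * L) S1 P)) i) <= A * beta ^+ j.
Proof.
move=> nN finD DS contr [/andP[eta0 _] prox] mu0 mub etab P DP.
have [E E0 PE] := prox P DP.
have [c Pc] := delta_finite (finD P DP).
have l0 : 0 <= mu * 2 ^- L by rewrite divr_ge0// exprn_ge0.
apply: (@geometric_recursion _ (fun j i => N (edge (edge (iter (j * L) S1 P)) i))
  (mu * 2 ^- L) eta (4 * E) beta (c + c)).
- by rewrite l0.
- by rewrite eta0.
- by rewrite mulr_ge0// ltW.
- by move=> i; rewrite mul0n (le_trans (is_norm_sub nN _ _))// lerD.
move=> j b jb i; rewrite mulSn iterD.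
set W := iter (j * L) S1 P in jb *.
have DW : D W by exact: iter_stable.
pose g : int -> 'rV[R]_n := fun i => iter L S1 W i - iter L S2 W i.
have gE k : N (g k) <= E * eta ^+ j.+1.
  rewrite -lee_fin; apply: le_trans (PE j); apply: ereal_sup_ubound.
  by exists k.
have eg k : N (edge g k) <= 2 * (E * eta ^+ j.+1).
  by rewrite (le_trans (is_norm_sub nN _ _))// mulr_natl mulr2n lerD.
have -> : edge (edge (iter L S1 W)) i =
    edge (edge (iter L S2 W)) i + edge (edge g) i.
  have gS : iter L S1 W = iter L S2 W \+ g.
    by apply/funext => k; rewrite /g /= addrC subrK.
  by rewrite gS (edgeD _ g) (edgeD _ (edge g)).
apply: (le_trans (norm_triangle nN _ _)); apply: lerD.
  exact: (contractive_second_edge nN mu0 contr DW jb i).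
apply: (le_trans (is_norm_sub nN _ _)).
by have := eg i; have := eg (i + 1); lra.
Qed.

(** The levels [k] congruent to [q] modulo [L] are the block iterates that start
    from [S1^q P], which lies in [D]; the constants of the [L] residues are added.
    The rate [(sigma ^+ 2 / 2) ^+ L] must exceed both [mu / 2^L] and [eta], and
    [sigma < 1] can be so chosen because [mu < 1] and [2^L * eta < 1]. *)
Lemma second_edge_decay (R : realType) (n : nat) (N : 'rV[R]_n -> R)
    (D : set (int -> 'rV[R]_n)) (S1 S2 : scheme R n) (mu eta : R) (L : nat) :
  is_norm N ->
  (forall P, D P -> (delta N P < +oo)%E) ->
  (forall P, D P -> D (S1 P)) ->
  first_order_contractive N D S2 mu L ->
  second_type_proximity N D S1 S2 L 1 eta ->
  (0 < L)%N -> 0 < mu < 1 -> 0 < eta < 2 ^- L ->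
  forall P, D P -> exists A sigma : R, [/\ 0 <= A, 0 < sigma < 1 &
    forall k i, N (edge (edge (iter k S1 P)) i) <= A * (sigma ^+ 2 / 2) ^+ k].
Proof.
move=> nN finD DS contr prox L0 /andP[mu0 mu1] /andP[eta0 etaL] P DP.
have t0 : 0 < 2 ^+ L :> R by rewrite exprn_gt0.
have [sigma s01 rs] : exists2 sigma : R, 0 < sigma < 1 &
    Num.max mu (2 ^+ L * eta) < sigma ^+ (2 * L).
  apply: exists_large_power; rewrite lt_max mu0/= gt_max mu1/=.
  by rewrite -ltr_pdivlMl// mulr1.
pose rho := sigma ^+ 2 / 2.
have rho0 : 0 < rho by rewrite divr_gt0// exprn_gt0//; case/andP: s01.
have rhoL : rho ^+ L = sigma ^+ (2 * L) * 2 ^- L.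
  by rewrite /rho exprMn exprVn exprM.
move: rs; rewrite gt_max => /andP[mus etas].
have block q : exists A : R, forall j i,
    N (edge (edge (iter (j * L) S1 (iter q S1 P))) i) <= A * (rho ^+ L) ^+ j.
  apply: (second_edge_decay_block nN finD DS contr prox (ltW mu0)).
  - by rewrite rhoL ltr_pM2r ?invr_gt0.
  - by rewrite rhoL ler_pdivlMr// mulrC ltW.
  - exact: iter_stable.
have [a aP] := choice block.
pose A := \sum_(q < L) `|a q| / rho ^+ q.
exists A, sigma; split=> //.
  by apply: sumr_ge0 => q _; rewrite divr_ge0// exprn_ge0// ltW.
move=> k i; rewrite -/rho (divn_eq k L) iterD.
apply: (le_trans (aP (k %% L)%N (k %/ L)%N i)).
rewrite exprD mulnC exprM mulrCA [leLHS]mulrC ler_wpM2l ?exprn_ge0 ?(ltW rho0)//.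
rewrite -ler_pdivrMr ?exprn_gt0//.
have kL : (k %% L < L)%N by rewrite ltn_mod.
rewrite /A (bigD1 (Ordinal kL))//= -[leLHS]addr0; apply: lerD.
  by rewrite ler_wpM2r ?ler_norm// invr_ge0 exprn_ge0// ltW.
by apply: sumr_ge0 => q _; rewrite divr_ge0// exprn_ge0// ltW.
Qed.

(** * Knots and convergence *)
Definition knot_offset (R : realType) (T : parametrization) (k : nat) : R :=
  knot R T k 0.

Lemma knotE (R : realType) (T : parametrization) (k : nat) (j : int) :
  knot R T k j = j%:~R * 2 ^- k + knot_offset R T k.
Proof.
by case: T; rewrite /knot_offset /knot mulr0z mul0r ?addr0 ?add0r.
Qed.

(** Refinement moves the knot of index 0 by nothing (primal) or by half a step of
    the finer level (dual). *)
Lemma knot_offset_step (R : realType) (T : parametrization) (k : nat) :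
  0 <= 2 ^+ k.+1 * (knot_offset R T k.+1 - knot_offset R T k) <= 1.
Proof.
have t0 : 0 < 2 ^+ k.+1 :> R by rewrite exprn_gt0.
case: T; rewrite /knot_offset /knot !mul0r.
  by rewrite subrr mulr0 lexx ler01.
rewrite !add0r big_nat_recr//= addrAC subrr add0r [2 ^+ k.+2]exprS invfM.
rewrite mulrCA divff ?gt_eqF// mulr1.
by apply/andP; split; lra.
Qed.

Lemma pl_interpolant_pl (R : realType) (n : nat) (T : parametrization) (k : nat)
    (P : int -> 'rV[R]_n) :
  pl_interpolant (knot R T k) P
    (fun x => pl P (2 ^+ k * (x - knot_offset R T k))).
Proof.
move=> j x; rewrite !knotE; set tau := knot_offset _ _ _ => /andP[jx xj].
have t0 : 0 < 2 ^+ k :> R by rewrite exprn_gt0.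
set u := 2 ^+ k * (x - tau).
have ju : j%:~R <= u.
  by rewrite /u -ler_pdivrMl// mulrC lerBrDr.
have uj : u <= (j + 1)%:~R.
  by rewrite /u -ler_pdivlMl// mulrC lerBlDr.
rewrite (@pl_segment _ _ _ j) ?ju//.
have -> : (x - (j%:~R * 2 ^- k + tau)) /
   ((j + 1)%:~R * 2 ^- k + tau - (j%:~R * 2 ^- k + tau)) = u - j%:~R.
  rewrite intrD /u; field.
  by rewrite gt_eqF//= opprD addrACA subrr addr0 addrAC subrr add0r oner_eq0.
by rewrite /average /edge; move: (u - _) => w;
  rewrite scalerBl scale1r scalerBr -addrA [- _ + _]addrC.
Qed.

Theorem theorem6p6 (R : realType) (n : nat) (N : 'rV[R]_n -> R)
  (normN : is_norm N)
  (D : set (int -> 'rV[R]_n))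
  (finD : forall P, D P -> (delta N P < +oo)%E)
  (S1 S2 : scheme R n) (mu1 : R) (L1 : nat) (eta : R)
  (mu1_itv : 0 < mu1 < 1)
  (L1_gt0 : (0 < L1)%N)
  (contrS2 : first_order_contractive N D S2 mu1 L1)
  (same_params : params S1 = params S2)
  (stableD : forall P, D P -> D (S1 P))
  (proxS1S2 : second_type_proximity N D S1 S2 L1 1 eta)
  (eta_itv : 0 < eta < 2 ^- L1)
  (safeS1 : displacement_safe N D S1) :
  forall P, D P -> exists2 Q : R -> 'rV[R]_n, converges_to N S1 P Q & C1 Q.
Proof.
move=> P DP.
have [A [sigma [A0 s01 decay]]] :=
  second_edge_decay normN finD stableD contrS2 proxS1S2 L1_gt0 mu1_itv eta_itv DP.
have [K K0 NK] := is_norm_le normN; have [K' K'0 NK'] := is_norm_ge normN.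
have [C C0 safe] := safeS1.
pose p k := iter k S1 P.
have flat : flattening_levels p (K' * C * K) (K' * A) sigma.
  split=> //.
  - by rewrite !mulr_ge0// ltW.
  - by rewrite mulr_ge0// ltW.
  - have [d Pd] := delta_finite (finD P DP).
    exists (K' * d) => i; apply: (le_trans (NK' _)).
    by rewrite ler_wpM2l// ltW.
  - move=> k d pd i; apply: (le_trans (NK' _)).
    rewrite -!mulrA ler_wpM2l ?(ltW K'0)//.
    have Dp : D (p k) by exact: iter_stable.
    rewrite -lee_fin; apply: (le_trans (safe _ i Dp)).
    rewrite EFinM; apply: lee_wpmul2l; first by rewrite lee_fin.
    apply/delta_le => j; apply: (le_trans (NK _)).
    by apply: ler_wpM2l (pd j); exact: ltW.
  - move=> k i; apply: (le_trans (NK' _)); rewrite -mulrA.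
    by apply: ler_wpM2l (decay k i); exact: ltW.
have [Q [[M QM] [Qd Qc]]] :=
  flattening_levels_C1 flat (knot_offset_step R (params S1)).
exists Q; last exact: (conj Qd Qc).
exists (fun k x => pl (p k) (2 ^+ k * (x - knot_offset R (params S1) k))).
split=> [k|e e0]; first exact: pl_interpolant_pl.
have half : 0 < (2^-1 : R) < 1 by apply/andP; split; lra.
have e2 : 0 < e / 2 by rewrite divr_gt0.
have [k0 small] := geometric_small (K * M) half e2.
exists k0 => // k /= k0k x; apply: (le_lt_trans (NK _)).
apply: (@le_lt_trans _ _ (e / 2)); last by lra.
apply: le_trans (small k k0k).
by rewrite -mulrA ler_wpM2l ?QM// ltW.
Qed.
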